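(* For $d\ge 1$ let $S_d$ be the maximal cardinality of a neighborly family of $d$-dimensional simplices in $\mathbb{R}^d$. Then $$\lim_{d\rightarrow\infty}\left(2^{d+1}-S_d\right)=\infty .$$
   Context: Two $d$-dimensional simplices in $\mathbb{R}^d$ are called neighborly if their intersection is a $(d-1)$-dimensional set. A family of $d$-dimensional simplices in $\mathbb{R}^d$ is called neighborly if every two (distinct) simplices of the family are neighborly. (It is known that such families have at most $2^{d+1}$ members, so $S_d$ is a well-defined integer.) *)

(* Defs.v *)
(* MathComp-Analysis; R^d is the type 'rV[R]_d of row vectors, with R : realType. *)
From HB Require Import structures.
From mathcomp Require Import all_boot all_order all_algebra.
From mathcomp Require Import all_classical all_reals all_analysis.
Set Implicit Arguments.
Unset Strict Implicit.
Unset Printing Implicit Defensive.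
Import Order.TTheory GRing.Theory Num.Theory.
Import numFieldNormedType.Exports.
Local Open Scope classical_set_scope.
Local Open Scope ring_scope.

Definition affinely_independent (R : realType) (d n : nat)
    (v : 'I_n -> 'rV[R]_d) : Prop :=
  forall a : 'I_n -> R,
    \sum_i a i = 0 -> \sum_i a i *: v i = 0 -> forall i, a i = 0.

Definition convex_hull (R : realType) (d n : nat)
    (v : 'I_n -> 'rV[R]_d) : set 'rV[R]_d :=
  [set x | exists a : 'I_n -> R,
    [/\ forall i, 0 <= a i, \sum_i a i = 1 & x = \sum_i a i *: v i]].

Definition simplex (R : realType) (d k : nat) (A : set 'rV[R]_d) : Prop :=
  exists2 v : 'I_k.+1 -> 'rV[R]_d,
    affinely_independent v & A = convex_hull v.

Definition affine_hull (R : realType) (d : nat)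
    (A : set 'rV[R]_d) : set 'rV[R]_d :=
  [set x | exists n (v : 'I_n -> 'rV[R]_d) (a : 'I_n -> R),
    [/\ forall i, A (v i), \sum_i a i = 1 & x = \sum_i a i *: v i]].

(* The affine hull of A is a translate of a linear subspace of dimension k.
   The empty set has no dimension in this sense. *)
Definition has_dim (R : realType) (d : nat) (A : set 'rV[R]_d) (k : nat) :
    Prop :=
  exists (x : 'rV[R]_d) (U : {vspace 'rV[R]_d}),
    affine_hull A = [set x + u | u in [set` U]] /\ \dim U = k.

(* Meant for d >= 1: the predecessor d.-1 is truncated at 0. *)
Definition neighborly (R : realType) (d : nat) (A B : set 'rV[R]_d) : Prop :=
  has_dim (A `&` B) d.-1.

Definition neighborly_family (R : realType) (d : nat)
    (F : set (set 'rV[R]_d)) : Prop :=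
  (forall A, F A -> simplex d A) /\
  (forall A B, F A -> F B -> A <> B -> neighborly A B).

(* The largest cardinality of a neighborly family in R^d. As counting F is +oo
   when F is infinite, the value is +oo if these cardinalities are unbounded;
   otherwise it is attained, see max_neighborly_attained. *)
Definition max_neighborly (R : realType) (d : nat) : \bar R :=
  ereal_sup [set counting F | F in @neighborly_family R d].

Lemma max_neighborly_attained (R : realType) (d : nat) :
  max_neighborly R d \is a fin_num ->
  exists F : set (set 'rV[R]_d),
    [/\ neighborly_family F, finite_set F & max_neighborly R d = counting F].
Proof.
move=> Sfin; have half0 : (0 < 2^-1 :> R) by rewrite invr_gt0.
have [_ [F nF <-] SF] := ub_ereal_sup_adherent half0 Sfin.
have leS (G : set (set ('rV[R]_d))) : neighborly_family G -> (counting G <= max_neighborly R d)%E.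
  by move=> nG; apply: ereal_sup_ubound; exists G.
have finG (G : set (set ('rV[R]_d))) : neighborly_family G -> finite_set G.
  move=> nG; have := leS _ nG; rewrite /counting; case: asboolP => //= _.
  by rewrite leye_eq => /eqP Sy; rewrite Sy in Sfin.
exists F; split=> //; first exact: finG.
apply/eqP; rewrite eq_le leS // andbT.
apply: ge_ereal_sup => _ [G nG <-].
move: (leS _ nG) SF; rewrite -/(max_neighborly R d) /counting.
rewrite (asboolT (finG _ nG)) (asboolT (finG _ nF)).
rewrite -(fineK Sfin) -EFinB !lee_fin lte_fin => GS SF.
rewrite ler_nat -ltnS -(ltr_nat R) -natr1.
apply: (le_lt_trans GS); move: SF; rewrite ltrBlDr => /lt_le_trans; apply.
by rewrite lerD2l invf_le1 // ler1n.
Qed.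

(* Main.v *)
(* A neighborly family is encoded as a code over {-1, 0, 1}: the coordinates are
   the hyperplanes spanned by facets, and the word of a simplex records on which
   side of each of its m = d + 1 facet hyperplanes it lies. If two simplices
   meet in dimension d - 1, the affine hull of their intersection is the only
   hyperplane spanned by facets of both that separates them, so two distinct
   words are opposite in exactly one coordinate. Their supports differ as well,
   because barycentric coordinates sum to 1.
   Let k be the number of words. Read as subcubes of a discrete cube they are
   disjoint, and the indicator of the uncovered part has mean 1 - k / 2^m. Delete
   one coordinate from the support of a word: if the resulting set of size m - 1
   lies in no other support, the Fourier coefficient of that indicator at this
   set is +2^-m or -2^-m. At most 6 deletions per word fail to have this
   property, so Bessel's inequality gives k (m - 6) <= 2^m (2^m - k), whence
   2^m - k >= (m - 6) / 2. *)
Require Import Defs.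
From HB Require Import structures.
From mathcomp Require Import all_boot all_order all_algebra.
From mathcomp Require Import all_classical all_reals all_analysis.
From mathcomp Require Import finmap ring lra.
Set Implicit Arguments.
Unset Strict Implicit.
Unset Printing Implicit Defensive.
Import Order.TTheory GRing.Theory Num.Theory.
Import numFieldNormedType.Exports.
Local Open Scope ring_scope.

(** * Products of one-coordinate functions on the discrete cube *)

Definition sign_prod (R : pzRingType) (I : finType) (a b : I -> R)
    (x : {ffun I -> bool}) : R :=
  \prod_i (a i + b i * (-1) ^+ x i).

(** The sum over the cube factors coordinatewise, and in each factor the cross terms, odd in the
    sign, cancel. *)
Lemma sum_sign_prodM (R : comNzRingType) (I : finType) (a b a' b' : I -> R) :
  \sum_x sign_prod a b x * sign_prod a' b' x =
  2 ^+ #|I| * \prod_i (a i * a' i + b i * b' i).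
Proof.
transitivity (\prod_i \sum_(c : bool)
  (a i + b i * (-1) ^+ c) * (a' i + b' i * (-1) ^+ c)).
  by rewrite bigA_distr_bigA; apply: eq_bigr => x _; rewrite big_split.
have -> : 2 ^+ #|I| = \prod_(i : I) 2 :> R by rewrite prodr_const.
rewrite -big_split /=.
by apply: eq_bigr => i _; rewrite big_bool /=; ring.
Qed.

Definition supp (R : pzRingType) (I : finType) (w : I -> R) : {set I} :=
  [set i | w i != 0].

(** * Codes in which two distinct words are opposite exactly once *)

Section Code.
Variables (R : realFieldType) (K I : finType) (m : nat) (w : K -> I -> R).
Hypothesis w_sqr : forall v i, w v i != 0 -> w v i ^+ 2 = 1.
Hypothesis card_supp : forall v, #|supp (w v)| = m.
Hypothesis w_opp : forall u v, u != v -> exists i, w u i * w v i = -1.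
Hypothesis w_opp_uniq : forall u v i j, u != v ->
  w u i * w v i = -1 -> w u j * w v j = -1 -> i = j.
Hypothesis supp_inj : injective (fun v => supp (w v)).

Definition shared (v : K) (q : I) : bool :=
  [exists u, (u != v) && (supp (w v) :\ q \subset supp (w u))].

Definition private : {set K * I} :=
  [set z | (z.2 \in supp (w z.1)) && ~~ shared z.1 z.2].

Lemma opp_supp u v i : w u i * w v i = -1 -> i \in supp (w u).
Proof.
rewrite inE => uv; apply/eqP => u0.
by move/eqP: uv; rewrite u0 mul0r eq_sym oppr_eq0 oner_eq0.
Qed.

Lemma opp_supp_r u v i : w u i * w v i = -1 -> i \in supp (w v).
Proof. by rewrite mulrC; apply: opp_supp. Qed.

Lemma w_same u v i : i \in supp (w u) -> i \in supp (w v) ->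
  w u i * w v i <> -1 -> w u i = w v i.
Proof.
rewrite !inE => /w_sqr u1 /w_sqr v1 uv.
have /eqP : w u i ^+ 2 = w v i ^+ 2 by rewrite u1 v1.
rewrite eqf_sqr => /orP[/eqP//|/eqP uE].
by case: uv; rewrite uE mulNr -expr2 v1.
Qed.

Lemma opp_sign u v i : w u i * w v i = -1 -> w u i = - w v i.
Proof.
move=> uv; have : w v i ^+ 2 = 1.
  by apply: w_sqr; have := opp_supp_r uv; rewrite inE.
move=> v1; have : w u i * w v i * w v i = - w v i by rewrite uv mulN1r.
by rewrite -mulrA -expr2 v1 mulr1.
Qed.

(** Two different deletions together cover the whole support of [v]; nested supports of equal size
    coincide, against [supp_inj]. *)
Lemma supp_in_eq (v u : K) (q q' : I) : u != v -> q != q' ->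
  supp (w v) :\ q \subset supp (w u) ->
  supp (w v) :\ q' \subset supp (w u) -> False.
Proof.
move=> uv qq' /fintype.subsetP s /fintype.subsetP s'.
have : supp (w v) \subset supp (w u).
  apply/fintype.subsetP => i iv; case: (eqVneq i q) => [iq|iq].
    by apply: s'; rewrite in_setD1 iv iq qq'.
  by apply: s; rewrite in_setD1 iv iq.
move=> vu; have /eqP vE : supp (w v) == supp (w u).
  by rewrite eqEcard vu !card_supp leqnn.
by move/eqP: uv; apply; apply: supp_inj.
Qed.

(** Supports have size [m] and the deleted one has size [m - 1], which leaves room for a single
    further coordinate. *)
Lemma supp_extra (v u : K) (q i j : I) : q \in supp (w v) ->
  supp (w v) :\ q \subset supp (w u) ->
  i \in supp (w u) -> i \notin supp (w v) :\ q ->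
  j \in supp (w u) -> j \notin supp (w v) :\ q -> i = j.
Proof.
move=> qv s iu iS ju jS.
have : #|supp (w u) :\: (supp (w v) :\ q)| = 1%N.
  rewrite cardsDS // card_supp; have := card_supp v.
  by rewrite (cardsD1 q) qv add1n => <-; rewrite subSnn.
move=> /eqP/cards1P[e eE].
have /set1P -> : i \in [set e] by rewrite -eE inE iS.
by have /set1P -> : j \in [set e] by rewrite -eE inE jS.
Qed.

(* [U q] is a second word whose support contains that of [v] minus [q], and
   [P q] is where it differs from [v]. *)
Section Shared.
Variables (v : K) (B : {set I}) (U : I -> K) (P : I -> I).
Hypothesis B_supp : {subset B <= supp (w v)}.
Hypothesis U_neq : forall q, q \in B -> U q != v.
Hypothesis U_supp : forall q, q \in B -> supp (w v) :\ q \subset supp (w (U q)).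
Hypothesis P_opp : forall q, q \in B -> w (U q) (P q) * w v (P q) = -1.

Lemma U_inj q q' : q \in B -> q' \in B -> q != q' -> U q != U q'.
Proof.
move=> qB q'B qq'; apply/eqP => UE; apply: (supp_in_eq (U_neq qB) qq').
  exact: U_supp.
by rewrite UE; apply: U_supp.
Qed.

(** Otherwise [U q'] agrees with [v] at [P q], and [U q] agrees with [v] at [P q'], so [U q] and
    [U q'] are opposite at both places, against [w_opp_uniq]. *)
Lemma U_away q q' : q \in B -> q' \in B -> q != q' ->
  [|| P q == P q', P q == q' | P q' == q].
Proof.
move=> qB q'B qq'; apply/negPn/negP.
rewrite !negb_or => /and3P[PP Pq Pq'].
have key s t : s \in B -> t \in B -> P s != P t -> P s != t ->
    w (U s) (P s) * w (U t) (P s) = -1.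
  move=> sB tB Pst Pt.
  rewrite [w (U t) (P s)](@w_same _ v); first exact: P_opp.
  - by apply: (fintype.subsetP (U_supp tB)); rewrite in_setD1 Pt (opp_supp_r (P_opp sB)).
  - exact: (opp_supp_r (P_opp sB)).
  - move=> h; move/eqP: Pst; apply.
    exact: (w_opp_uniq (U_neq tB) h (P_opp tB)).
move/eqP: (PP); apply; apply: (w_opp_uniq (U_inj qB q'B qq')); first exact: key.
by rewrite mulrC; apply: key => //; rewrite eq_sym.
Qed.

(** Where both supports meet, [U q] agrees with [v] except at [P q], where it is opposite. Two such
    words with the same [P] therefore have equal signs at common coordinates of [v]. *)
Lemma U_same_P q q' i : q \in B -> q' \in B -> q != q' -> P q = P q' ->
  w (U q) i * w (U q') i = -1 -> i \notin supp (w v).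
Proof.
move=> qB q'B qq' PP opp; apply/negP => iv.
wlog iq : q q' qB q'B qq' PP opp / i != q.
  move=> W; case: (eqVneq i q) => [iq|]; last exact: (W q q').
  by apply: (W q' q) => //; [rewrite eq_sym|rewrite mulrC|rewrite iq].
have iU : i \in supp (w (U q)) by exact: opp_supp opp.
have iU' : i \in supp (w (U q')) by exact: opp_supp_r opp.
case: (eqVneq i (P q)) => [iP|iP].
  have := opp; rewrite iP (opp_sign (P_opp qB)) {2}PP (opp_sign (P_opp q'B)) -PP.
  rewrite mulrNN -expr2 => /eqP; rewrite w_sqr; last first.
    by have := opp_supp_r (P_opp qB); rewrite inE.
  by rewrite -subr_eq0 opprK -(natrD _ 1 1) pnatr_eq0.
have h s : s \in B -> P q = P s -> i \in supp (w (U s)) -> w (U s) i = w v i.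
  move=> sB Ps is_; apply: w_same => // e; move/eqP: iP; apply.
  by rewrite Ps; apply: (w_opp_uniq (U_neq sB) e (P_opp sB)).
have := opp; rewrite (h q) // (h q') // -expr2 => /eqP.
rewrite w_sqr; last by move: iv; rewrite inE.
by rewrite -subr_eq0 opprK -(natrD _ 1 1) pnatr_eq0.
Qed.

(** Three words in one fiber would be pairwise opposite outside the support of [v]. Each has only
    one coordinate there, so all three oppositions occur at the same coordinate, which three signs
    cannot achieve. *)
Lemma P_fiber p : (#|[set q in B | P q == p]| <= 2)%N.
Proof.
rewrite leqNgt; apply/negP => /card_gt2P[a [b [c [[]]]]].
rewrite !inE => /andP[aB /eqP Pa] /andP[bB /eqP Pb] /andP[cB /eqP Pc] [ab bc ca].
have opp s t : s \in B -> t \in B -> s != t -> P s = P t ->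
    exists2 i, i \notin supp (w v) & w (U s) i * w (U t) i = -1.
  move=> sB tB st PP; have [i oi] := w_opp (U_inj sB tB st).
  by exists i => //; apply: U_same_P oi.
have [i iv oi] := opp a b aB bB ab (etrans Pa (esym Pb)).
have [j jv oj] := opp b c bB cB bc (etrans Pb (esym Pc)).
have [l lv ol] := opp c a cB aB ca (etrans Pc (esym Pa)).
have out s x : x \notin supp (w v) -> x \notin supp (w v) :\ s.
  by move=> xv; rewrite in_setD1 (negPf xv) andbF.
have ij : i = j := supp_extra (B_supp bB) (U_supp bB)
  (opp_supp_r oi) (out b i iv) (opp_supp oj) (out b j jv).
have jl : j = l := supp_extra (B_supp cB) (U_supp cB)
  (opp_supp_r oj) (out c j jv) (opp_supp ol) (out c l lv).
subst i l.
have := opp_sign oi; rewrite (opp_sign oj) (opp_sign ol) !opprK => e.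
have : w (U a) j == 0 by rewrite -eqNr; apply/eqP.
by have := opp_supp oi; rewrite inE => /negPf ->.
Qed.

(** For a fixed [q], [U_away] puts every [t] in [B] into the pair [q], [P q] or into the fiber of
    [P] over [q] or over [P q]; each of the three sets has at most 2 elements. *)
Lemma card_U : (#|B| <= 6)%N.
Proof.
have [->|[q qB]] := set_0Vmem B; first by rewrite cards0.
have : B \subset [set q; P q] :|: [set t in B | P t == q]
                 :|: [set t in B | P t == P q].
  apply/fintype.subsetP => t tB; rewrite !inE tB /=.
  case: (eqVneq t q) => //= tq; have := U_away qB tB; rewrite eq_sym => /(_ tq).
  by rewrite ![_ == P t]eq_sym (eq_sym (P q)) => /or3P[] ->; rewrite ?orbT.
move=> /subset_leq_card/leq_trans; apply.
apply: leq_trans (leq_card_setU _ _) _; rewrite -[6%N]/(4 + 2)%N.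
apply: leq_add (P_fiber _); apply: leq_trans (leq_card_setU _ _) _.
rewrite -[4%N]/(2 + 2)%N; apply: leq_add (P_fiber _).
by rewrite cards2; case: eqP.
Qed.

End Shared.

Lemma card_shared v : (#|[set q in supp (w v) | shared v q]| <= 6)%N.
Proof.
set B := [set _ in _ | _].
have ex q : exists u, q \in B -> (u != v) && (supp (w v) :\ q \subset supp (w u)).
  case: (boolP (q \in B)) => [|_]; last by exists v.
  by rewrite inE => /andP[_ /existsP[u h]]; exists u.
pose U q := odflt v [pick u | (u != v) && (supp (w v) :\ q \subset supp (w u))].
have UP q : q \in B -> (U q != v) && (supp (w v) :\ q \subset supp (w (U q))).
  move=> qB; rewrite /U; case: pickP => //= n.
  by have [u /(_ qB)] := ex q; rewrite n.
pose P q := odflt q [pick i | w (U q) i * w v i == -1].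
have PP q : q \in B -> w (U q) (P q) * w v (P q) = -1.
  move=> qB; rewrite /P; case: pickP => /= [i /eqP//|n].
  have /andP[/w_opp[i /eqP]] := UP q qB.
  by rewrite n.
apply: (@card_U v B U P) => // q qB.
- by move: qB; rewrite inE => /andP[].
- by case/andP: (UP q qB).
- by case/andP: (UP q qB).
Qed.

Lemma card_private : (#|K| * m <= #|private| + 6 * #|K|)%N.
Proof.
have -> : #|private| = (\sum_v #|[set q in supp (w v) | ~~ shared v q]|)%N.
  rewrite -sum1_card (eq_bigl (fun z : K * I =>
    true && (z.2 \in supp (w z.1)) && ~~ shared z.1 z.2)); last first.
    by move=> z; rewrite inE.
  rewrite -(pair_big_dep xpredT (fun v q => (q \in supp (w v)) && ~~ shared v q)
    (fun _ _ => 1%N)) /=; apply: eq_bigr => v _.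
  by rewrite -sum1_card; apply: eq_bigl => q; rewrite !inE.
rewrite -[(6 * _)%N]mulnC -!sum_nat_const -big_split /=; apply: leq_sum => v _.
rewrite -(card_supp v) -(cardsID [set q | shared v q]) addnC leq_add //.
  by apply/eq_leq/eq_card => q; rewrite !inE andbC.
apply: leq_trans (card_shared v); apply/eq_leq/eq_card => q.
by rewrite !inE.
Qed.

(** This is [2 ^+ m] times the indicator of the subcube where the signs of [x] agree with [w v] on
    its support. *)
Definition box v : {ffun I -> bool} -> R := sign_prod (fun=> 1) (w v).

(** The Walsh character of the support with [z.2] deleted, multiplied by the signs of the word on
    that set. *)
Definition mono (z : K * I) : {ffun I -> bool} -> R :=
  sign_prod (fun i => (i \notin supp (w z.1) :\ z.2)%:R)
    (fun i => (i \in supp (w z.1) :\ z.2)%:R * w z.1 i).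

Local Notation vol := (2 ^+ #|I| : R).

Lemma prod_zero (f : I -> R) i : f i = 0 -> \prod_i f i = 0.
Proof. by move=> fi; rewrite (bigD1 i) //= fi mul0r. Qed.

(** The factor at an opposite coordinate is zero: subcubes of distinct words are disjoint. *)
Lemma sum_boxM u v :
  \sum_x box u x * box v x = vol * (2 ^+ m * (u == v)%:R).
Proof.
rewrite /box sum_sign_prodM; congr (_ * _).
case: eqVneq => [->|/w_opp[i oi]]; last first.
  by rewrite mulr0; apply: (@prod_zero _ i); rewrite oi mulr1 subrr.
rewrite [RHS]mulr1 -(card_supp v) -prodr_const [RHS]big_mkcond /=.
apply: eq_bigr => i _; rewrite inE mulr1 -expr2.
by case: eqP => [->|/eqP/w_sqr ->]; rewrite ?expr0n ?addr0.
Qed.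

Lemma sum_box v : \sum_x box v x = vol.
Proof.
(* The constant 1 is itself a [sign_prod], with coefficients 1 and 0. *)
have := sum_sign_prodM (fun=> 1) (w v) (fun=> 1) (fun=> 0).
rewrite [in RHS]big1; last by move=> i _; rewrite mulr0 addr0 mulr1.
rewrite mulr1 => <-; apply: eq_bigr => x _.
rewrite [X in _ * X]big1 ?mulr1 // => i _.
by rewrite mul0r addr0.
Qed.

(** A character of a nonempty set has mean zero; [1 < m] keeps the set nonempty after one
    deletion. *)
Lemma sum_mono z : (1 < m)%N -> \sum_x mono z x = 0.
Proof.
move=> m1; pose S := supp (w z.1) :\ z.2.
have [i iS] : exists i, i \in S.
  apply/set0Pn; rewrite -card_gt0 -(ltn_add2l (z.2 \in supp (w z.1))) -cardsD1.
  by rewrite card_supp addn0; case: (z.2 \in _) => //; apply: ltnW.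
have := sum_sign_prodM (fun i => (i \notin S)%:R)
  (fun i => (i \in S)%:R * w z.1 i) (fun=> 1) (fun=> 0).
rewrite [in RHS](@prod_zero _ i) ?[RHS]mulr0; last by rewrite iS mul0r mulr0 addr0.
move=> h; rewrite -[RHS]h.
apply: eq_bigr => x _; rewrite [X in _ * X]big1 ?mulr1 // => j _.
by rewrite mul0r addr0.
Qed.

(** A box correlates only with characters of subsets of its support, and a private set lies in no
    support but that of its own word. *)
Lemma sum_box_mono v z : z \in private ->
  \sum_x box v x * mono z x = vol * (v == z.1)%:R.
Proof.
rewrite inE => /andP[qs nsh]; rewrite sum_sign_prodM; congr (_ * _).
case: eqVneq => [->|vz].
  apply: big1 => i _; rewrite mul1r mulrCA -expr2.
  case: (boolP (i \in _)) => [|_]; last by rewrite mul0r addr0.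
  by rewrite !inE => /andP[_ /w_sqr ->]; rewrite add0r mulr1.
have /fintype.subsetPn[i iS iv] : ~~ (supp (w z.1) :\ z.2 \subset supp (w v)).
  by apply: contra nsh => h; apply/existsP; exists v; rewrite vz.
apply: (@prod_zero _ i); rewrite iS /= mulr0 add0r.
by move: iv; rewrite inE negbK => /eqP ->; rewrite mul0r.
Qed.

Lemma private_inj z z' : z \in private -> z' \in private ->
  supp (w z.1) :\ z.2 = supp (w z'.1) :\ z'.2 -> z = z'.
Proof.
case: z z' => [v q] [v' q']; rewrite !inE /= => /andP[qv nsh] /andP[qv' nsh'] SS.
have vv : v = v'.
  apply/eqP; apply: contraNT nsh => vv'; apply/existsP; exists v'.
  by rewrite eq_sym vv' SS subD1set.
subst v'; congr (_, _).
have : q \notin supp (w v) :\ q' by rewrite -SS setD11.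
by rewrite !inE qv andbT negbK => /eqP.
Qed.

Lemma sum_monoM z z' : z \in private -> z' \in private ->
  \sum_x mono z x * mono z' x = vol * (z == z')%:R.
Proof.
move=> zp zp'; rewrite sum_sign_prodM; congr (_ * _).
case: eqVneq => [->|zz'].
  apply: big1 => i _; case: (boolP (i \in _)) => [|_]; last first.
    by rewrite !mul0r addr0 mulr1.
  by rewrite !inE => /andP[_ /w_sqr e]; rewrite mul0r add0r !mul1r -expr2 e.
have : supp (w z.1) :\ z.2 != supp (w z'.1) :\ z'.2.
  by apply: contraNneq zz' => /(private_inj zp zp') ->.
rewrite finset.eqEsubset negb_and => /orP[] /fintype.subsetPn[i i1 i2];
  by apply: (@prod_zero _ i); rewrite i1 (negPf i2) /= !(mul0r, mulr0) addr0.
Qed.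

(* Bessel's inequality for the indicator of the uncovered part of the cube,
   scaled by [2 ^+ m]. *)
Lemma card_private_le : (1 < m)%N ->
  (#|private|%:R <= 2 ^+ m * (2 ^+ m - #|K|%:R) :> R).
Proof.
move=> m1; set N : R := #|private|%:R; set k : R := #|K|%:R.
pose F x := \sum_v box v x; pose M x := \sum_(z in private) mono z x.
have FF : \sum_x F x * F x = vol * (k * 2 ^+ m).
  transitivity (\sum_v \sum_u \sum_x box v x * box u x).
    under eq_bigr do rewrite big_distrlr.
    by rewrite exchange_big; apply: eq_bigr => v _; rewrite exchange_big.
  under eq_bigr => v _.
    rewrite (bigD1 v) //= sum_boxM eqxx mulr1 big1 ?addr0; last first.
      by move=> u /negPf uv; rewrite sum_boxM eq_sym uv !mulr0.
    over.
  by rewrite sumr_const -[#|_|]/#|K|  -/k -[LHS]mulr_natr /k; ring.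
have FM : \sum_x F x * M x = vol * N.
  transitivity (\sum_(z in private) \sum_v \sum_x box v x * mono z x).
    under eq_bigr do rewrite big_distrlr.
    rewrite exchange_big /= (eq_bigr _ (fun v _ => exchange_big _ _ _ _ _ _)) /=.
    by rewrite exchange_big.
  under eq_bigr => z zp.
    rewrite (bigD1 z.1) //= sum_box_mono // eqxx mulr1 big1 ?addr0; last first.
      by move=> u /negPf uv; rewrite sum_box_mono // uv !mulr0.
    over.
  by rewrite sumr_const /N mulr_natr.
have MM : \sum_x M x * M x = vol * N.
  transitivity (\sum_(z in private) \sum_(t in private) \sum_x mono z x * mono t x).
    under eq_bigr do rewrite big_distrlr.
    by rewrite exchange_big; apply: eq_bigr => v _; rewrite exchange_big.
  under eq_bigr => z zp.
    rewrite (bigD1 z) //= sum_monoM // eqxx mulr1 big1 ?addr0; last first.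
      by move=> u /andP[up /negPf uz]; rewrite sum_monoM // eq_sym uz !mulr0.
    over.
  by rewrite sumr_const /N mulr_natr.
have F1 : \sum_x F x = vol * k.
  rewrite exchange_big /= (eq_bigr (fun=> vol)); last by move=> v _; exact: sum_box.
  by rewrite sumr_const -[#|_|]/#|K| /k mulr_natr.
have M1 : \sum_x M x = 0.
  by rewrite exchange_big /= big1 // => z _; apply: sum_mono.
have c1 : \sum_(x : {ffun I -> bool}) (1 : R) = vol.
  by rewrite sumr_const -[#|_|]/#|{: {ffun I -> bool}}| card_ffun card_bool natrX.
have vol0 : 0 < vol by rewrite exprn_gt0.
(* By [FM] and [MM], the projection of [2 ^+ m - F] onto the span of the private characters is
   [- M]; the squared residual is summed here. *)
have : 0 <= \sum_x (2 ^+ m - F x + M x) ^+ 2 by apply: sumr_ge0 => x _; exact: sqr_ge0.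
have -> : \sum_x (2 ^+ m - F x + M x) ^+ 2 =
    vol * (2 ^+ m * (2 ^+ m - k) - N).
  rewrite (eq_bigr (fun x => (2 ^+ m) ^+ 2 * 1 + F x * F x + M x * M x
    - 2 * 2 ^+ m * F x + 2 * 2 ^+ m * M x - 2 * (F x * M x))); last first.
    by move=> x _; ring.
  by rewrite !(sumrB, big_split) /= -!mulr_sumr FF FM MM F1 M1 c1; ring.
by rewrite pmulr_rge0 // subr_ge0.
Qed.

(** With k words, the two bounds give k (m - 6) <= 2^m (2^m - k). If k is at least half of 2^m,
    divide by 2^m; otherwise 2^m - k exceeds 2^m / 2, which is at least m / 2. *)
Lemma card_code_le : (6 <= m)%N -> (#|K|%:R + (m%:R - 6) / 2 <= 2 ^+ m :> R).
Proof.
move=> m6; have := card_private_le (leq_trans _ m6) => /(_ isT).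
have := card_private; rewrite -(ler_nat R) natrD !natrM.
have : (6%:R <= m%:R :> R) by rewrite ler_nat.
have : (m%:R <= 2 ^+ m :> R) by rewrite -natrX ler_nat ltnW // ltn_expl.
by move: (2 ^+ m) => Q; nra.
Qed.

End Code.

Local Open Scope classical_set_scope.
Local Open Scope ring_scope.

(** * Affine functions, barycentric coordinates and separating hyperplanes *)

Section Geometry.
Variables (R : realType) (d : nat).
Implicit Types (x y z : 'rV[R]_d) (c e : 'cV[R]_(1 + d)) (A B X : set 'rV[R]_d).

(* Affine functions on R^d are column vectors acting on homogeneous coordinates. *)
Definition hat x : 'rV[R]_(1 + d) := row_mx 1%:M x.
Definition ev c x : R := (hat x *m c) 0 0.

Lemma evE c x : ev c x = usubmx c 0 0 + (x *m dsubmx c) 0 0.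
Proof. by rewrite /ev /hat -{1}[c]vsubmxK mul_row_col mul1mx mxE. Qed.

Lemma evZ a c x : ev (a *: c) x = a * ev c x.
Proof. by rewrite /ev -scalemxAr mxE. Qed.

Lemma ev_shift c x z t : ev c (x + t *: z) = ev c x + t * (z *m dsubmx c) 0 0.
Proof. by rewrite !evE mulmxDl -scalemxAl !mxE addrA. Qed.

Lemma hat_sum (I : finType) (v : I -> 'rV[R]_d) (a : I -> R) : \sum_i a i = 1 ->
  hat (\sum_i a i *: v i) = \sum_i a i *: hat (v i).
Proof.
move=> a1; rewrite -[RHS]hsubmxK !linear_sum; congr row_mx.
  under eq_bigr do rewrite linearZ /= row_mxKl.
  by rewrite -scaler_suml a1 scale1r.
by apply: eq_bigr => i _; rewrite linearZ /= row_mxKr.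
Qed.

Lemma ev_sum c (I : finType) (v : I -> 'rV[R]_d) (a : I -> R) : \sum_i a i = 1 ->
  ev c (\sum_i a i *: v i) = \sum_i a i * ev c (v i).
Proof.
move=> a1; rewrite /ev hat_sum // mulmx_suml summxE.
by apply: eq_bigr => i _; rewrite -scalemxAl mxE.
Qed.

Lemma ev_inj c e : (forall x, ev c x = ev e x) -> c = e.
Proof.
move=> ce; have h := ce 0; rewrite !evE !mul0mx !mxE !addr0 in h.
rewrite -[c]vsubmxK -[e]vsubmxK; congr col_mx.
  by apply/matrixP => i j; rewrite !ord1 !mxE.
apply/row_matrixP => i; have := ce (delta_mx 0 i).
rewrite !evE -!rowE !mxE h => /addrI hi.
by apply/rowP => j; rewrite !ord1 !mxE.
Qed.

(** The columns of [Q] are the barycentric coordinates: [Q] inverts the matrix of homogeneous vertex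
    coordinates, which is invertible by affine independence. *)
Lemma simplexP A : simplex d A -> exists Q : 'M[R]_(1 + d),
  [/\ Q \in unitmx, forall x, \sum_j ev (col j Q) x = 1 &
      forall x, A x <-> forall j, 0 <= ev (col j Q) x].
Proof.
move=> [p indep ->]; pose P : 'M[R]_(1 + d) := \matrix_j hat (p j).
have mulP (a : 'rV[R]_(1 + d)) : a *m P = \sum_j a 0 j *: hat (p j).
  by rewrite mulmx_sum_row; apply: eq_bigr => j _; rewrite rowK.
have lP (a : 'rV[R]_(1 + d)) : lsubmx (a *m P) 0 0 = \sum_j a 0 j.
  rewrite mulP linear_sum; under eq_bigr do rewrite linearZ /= row_mxKl.
  by rewrite -scaler_suml scalemx1 mxE eqxx mulr1n.
have rP (a : 'rV[R]_(1 + d)) : rsubmx (a *m P) = \sum_j a 0 j *: p j.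
  by rewrite mulP linear_sum; apply: eq_bigr => j _; rewrite linearZ /= row_mxKr.
have Pu : P \in unitmx.
  rewrite -row_free_unit; apply: inj_row_free => a aP0.
  apply/rowP => j; rewrite mxE; apply: (indep (fun j => a 0 j)).
    by rewrite -lP aP0 linear0 mxE.
  by rewrite -rP aP0 linear0.
have evQ x j : ev (col j (invmx P)) x = (hat x *m invmx P) 0 j.
  by rewrite /ev colE mulmxA -colE mxE.
have lhat x : \sum_j (hat x *m invmx P) 0 j = 1.
  by rewrite -lP mulmxKV // /hat row_mxKl mxE eqxx.
exists (invmx P); split; first by rewrite unitmx_inv.
  by move=> x; rewrite -(lhat x); apply: eq_bigr => j _; rewrite evQ.
move=> x; split=> [[a [a0 a1 ->]] j|x0].
  rewrite evQ hat_sum //.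
  have -> : \sum_i a i *: hat (p i) = (\row_i a i) *m P.
    by rewrite mulP; apply: eq_bigr => i _; rewrite mxE.
  by rewrite mulmxK // mxE.
exists (fun j => (hat x *m invmx P) 0 j); split.
- by move=> j; rewrite -evQ.
- exact: lhat.
- by rewrite -rP mulmxKV // /hat row_mxKr.
Qed.

(** The affine hull of [X] is a hyperplane, so its equation is unique up to a scalar. *)
Lemma hull_functional X : (0 < d)%N -> has_dim X d.-1 ->
  exists e0, [/\ X !=set0, e0 != 0, forall x, X x -> ev e0 x = 0 &
    forall e, (forall x, X x -> ev e x = 0) -> exists a, e = a *: e0].
Proof.
move=> d0 [x0 [U [hullE dimU]]].
have van e : (forall x, X x -> ev e x = 0) ->
    ev e x0 = 0 /\ forall u, u \in U -> (u *m dsubmx e) 0 0 = 0.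
  move=> eX; have hull0 x : affine_hull X x -> ev e x = 0.
    move=> [n [v [a [Xv a1 ->]]]]; rewrite ev_sum // big1 // => i _.
    by rewrite eX ?mulr0.
  have e0 : ev e x0 = 0.
    by apply: hull0; rewrite hullE; exists 0; rewrite ?addr0 //= mem0v.
  split=> // u uU; have : ev e (x0 + 1 *: u) = 0.
    by apply: hull0; rewrite hullE; exists u; rewrite ?scale1r.
  by rewrite ev_shift e0 add0r mul1r.
have [y yU] : exists y, y \notin U.
  apply/not_existsP => h; have : \dim {:'rV[R]_d} = \dim U.
    congr (\dim _); apply/vspaceP => z; rewrite memvf; apply/esym/negbNE/negP.
    exact: h.
  rewrite dimvf dim_matrix mul1r dimU => dE.
  by have := prednK d0; rewrite -dE => /esym/n_Sn.
have Uy0 : (U :&: <[y]> = 0)%VS.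
  apply/eqP; rewrite -subv0; apply/subvP => z; rewrite memv_cap => /andP[zU].
  move=> /vlineP[a zE]; case: (eqVneq a 0) => [a0|a0].
    by rewrite zE a0 scale0r mem0v.
  by move: zU; rewrite zE rpredZeq (negPf a0) (negPf yU).
have y0 : y != 0 by apply: contraNneq yU => ->; rewrite mem0v.
have Uy : (U + <[y]> = fullv)%VS.
  apply/eqP; rewrite eqEdim subvf dimvf dim_matrix mul1r.
  by rewrite dimv_disjoint_sum // dim_vline dimU y0 addn1 prednK /=.
have ext (n : 'cV[R]_d) : (forall u, u \in U -> u *m n = 0) -> y *m n = 0 -> n = 0.
  move=> nU ny; apply/row_matrixP => i; rewrite row0 rowE.
  have : delta_mx 0 i \in (U + <[y]>)%VS by rewrite Uy memvf.
  move=> /memv_addP[u uU [w /vlineP[a ->] ->]].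
  by rewrite mulmxDl nU // -scalemxAl ny scaler0 addr0.
have [n0 [n0U n0y]] : exists n : 'cV[R]_d,
    (forall u, u \in U -> u *m n = 0) /\ y *m n != 0.
  (* The projection onto the line of [y] along [U]; composed with a coordinate at which [y] is
     nonzero, it is a form killing [U] but not [y]. *)
  pose f := daddv_pi <[y]> U.
  have [k yk] : exists k, y 0 k != 0.
    apply/existsP; apply: contraNT y0; rewrite negb_exists => /forallP h.
    by apply/eqP/rowP => k; rewrite mxE; apply/eqP/negbNE.
  exists (col k (lin1_mx f)); split=> [u uU|].
    rewrite colE mulmxA -colE mul_rV_lin1.
    have := daddv_pi_add Uy0 (subvP (addvSl U <[y]>) u uU).
    rewrite daddv_pi_id // => /eqP; rewrite addrC -subr_eq0 addrK => /eqP fu.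
    by rewrite [X in col k X]fu linear0.
  rewrite colE mulmxA -colE mul_rV_lin1 [X in col k X]daddv_pi_id ?memv_line 1?capvC //.
  by apply: contraNneq yk => /matrixP/(_ 0 0); rewrite !mxE => ->.
pose e0 : 'cV[R]_(1 + d) := col_mx (- (x0 *m n0)) n0.
have e0E : forall x, X x -> ev e0 x = 0.
  move=> x Xx; have : affine_hull X x.
    exists 1%N, (fun=> x), (fun=> 1); split=> //; rewrite big_ord1 //.
    by rewrite scale1r.
  rewrite hullE => -[u uU <-]; rewrite evE /e0 col_mxKu col_mxKd mulmxDl (n0U u) //.
  by rewrite addr0 !mxE addrC subrr.
exists e0; split=> //.
- have : affine_hull X x0 by rewrite hullE; exists 0; rewrite ?addr0 //= mem0v.
  move=> [[|n] [v [a [Xv a1 _]]]]; last by exists (v ord0).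
  by move: a1; rewrite big_ord0 => /eqP; rewrite eq_sym oner_eq0.
- apply: contraNneq n0y => e00; have : dsubmx e0 = 0 by rewrite e00 linear0.
  by rewrite /e0 col_mxKd => ->; rewrite mulmx0.
- move=> e /van [ex0 eU].
  have n0y0 : (y *m n0) 0 0 != 0.
    by apply: contraNneq n0y => h; apply/eqP/matrixP => i j; rewrite !ord1 h mxE.
  (* The ratio of the two linear parts at [y]; both kill [U], and [U] and [y] span the space. *)
  exists ((y *m dsubmx e) 0 0 / (y *m n0) 0 0); set a := _ / _.
  have nE : dsubmx e = a *: n0.
    apply/eqP; rewrite -subr_eq0; apply/eqP/ext => [u uU|].
      rewrite mulmxBr -scalemxAr n0U // scaler0 subr0.
      by apply/matrixP => i j; rewrite !ord1 eU // mxE.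
    rewrite mulmxBr -scalemxAr; apply/matrixP => i j; rewrite !ord1.
    by rewrite [LHS]mxE [X in _ + X]mxE [X in _ - X]mxE [RHS]mxE divfK ?subrr.
  rewrite -[e]vsubmxK nE /e0 scale_col_mx; congr col_mx.
  move: ex0; rewrite evE nE -scalemxAr => h.
  apply/matrixP => i j; rewrite !ord1; rewrite [X in _ + X]mxE in h.
  by rewrite [RHS]mxE [X in _ * X]mxE mulrN; apply/eqP; rewrite -addr_eq0; apply/eqP.
Qed.


(* Otherwise one can leave the zero set of [e0] inside [X], moving along the
   normal of [e0] from an average of points of [X] at which the constraints that
   are not identically zero on [X] are positive. *)
Lemma negative_constraint (L : finType) (c : L -> 'cV[R]_(1 + d)) X e0 :
  (forall x, X x <-> forall l, 0 <= ev (c l) x) -> X !=set0 -> e0 != 0 ->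
  (forall x, X x -> ev e0 x = 0) ->
  (forall l, (forall x, X x -> ev (c l) x = 0) -> exists a, c l = a *: e0) ->
  exists l a, a < 0 /\ c l = a *: e0.
Proof.
move=> XE [x1 Xx1] e00 e0X par; apply: contrapT => neg.
have Xge x l : X x -> 0 <= ev (c l) x by move=> /XE.
have {}par l : (forall x, X x -> ev (c l) x = 0) ->
    exists2 a, 0 <= a & c l = a *: e0.
  move=> /par[a cl]; exists a => //; rewrite leNgt; apply/negP => a0.
  by apply: neg; exists l, a.
(* The extra index [None] keeps the average meaningful when [L] is empty. *)
have /choice[p pX] (o : option L) : exists x, X x /\
    if o is Some l then (forall x, X x -> ev (c l) x = 0) \/ 0 < ev (c l) x
    else True.
  case: o => [l|]; last by exists x1.
  have [h|] := pselect (forall x, X x -> ev (c l) x = 0); first by exists x1; split=> //; left.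
  move=> /existsNP[x /not_implyP[Xx /eqP cx]]; exists x; split=> //; right.
  by rewrite lt_neqAle eq_sym cx Xge.
pose N : R := #|{: option L}|%:R.
have N0 : 0 < N by rewrite ltr0n card_option.
have sN : \sum_(o : option L) N^-1 = 1.
  by rewrite sumr_const -[#|_|]/#|{: option L}| -mulr_natl mulfV ?gt_eqF.
pose xb := \sum_o N^-1 *: p o.
have xbE e : ev e xb = \sum_o N^-1 * ev e (p o) by exact: ev_sum.
have cxb l : 0 <= ev (c l) xb.
  rewrite xbE; apply: sumr_ge0 => o _; rewrite mulr_ge0 ?invr_ge0 ?(ltW N0) //.
  by apply: Xge; case: (pX o).
have Xxb : X xb by apply/XE.
pose z := (dsubmx e0)^T; pose q := (z *m dsubmx e0) 0 0.
have qE : q = \sum_i dsubmx e0 i 0 ^+ 2.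
  by rewrite /q mxE; apply: eq_bigr => i _; rewrite mxE expr2.
(* With zero linear part [e0] would be constant, and it vanishes at [xb]. *)
have q0 : 0 < q.
  rewrite lt_neqAle eq_sym qE sumr_ge0 ?andbT; last by move=> i _; exact: sqr_ge0.
  apply: contraNneq e00 => /eqP; rewrite psumr_eq0; last by move=> i _; exact: sqr_ge0.
  move=> /allP h; have n0 : dsubmx e0 = 0.
    apply/matrixP => i j; rewrite !ord1; apply/eqP.
    rewrite [X in _ == X]mxE -sqrf_eq0; apply: h.
    exact: mem_index_enum.
  apply/eqP/ev_inj => x; have := e0X _ Xxb.
  by rewrite !evE n0 (linear0 dsubmx) !mulmx0 (linear0 usubmx) !mxE !addr0.
pose b l := (z *m dsubmx (c l)) 0 0.
(* The step [t = 1 / (1 + s)] is short enough to keep every constraint positive at [xb] nonnegative;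
   those with value 0 at [xb] add 0 to [s], since dividing by 0 yields 0. *)
pose s := \sum_l `|b l| / ev (c l) xb.
have s0 l : 0 <= `|b l| / ev (c l) xb by rewrite divr_ge0.
have s1 : 0 < 1 + s by rewrite ltr_pwDl // sumr_ge0.
pose t := (1 + s)^-1.
have t0 : 0 < t by rewrite invr_gt0.
have e0t : ev e0 (xb + t *: z) = t * q by rewrite ev_shift e0X // add0r.
have : X (xb + t *: z).
  apply/XE => l; have [_ [h|cl]] := pX (Some l).
    have [a a0 ->] := par l h.
    by rewrite evZ e0t mulr_ge0 // mulr_ge0 // ltW.
  have cxb0 : 0 < ev (c l) xb.
    rewrite xbE (bigD1 (Some l)) //= ltr_pwDl ?mulr_gt0 ?invr_gt0 //.
    apply: sumr_ge0 => o _; rewrite mulr_ge0 ?invr_ge0 ?(ltW N0) //.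
    by apply: Xge; case: (pX o).
  rewrite ev_shift -/(b l).
  have : t * `|b l| <= ev (c l) xb.
    rewrite /t mulrC ler_pdivrMr // -ler_pdivrMl // mulrC.
    rewrite /s (bigD1 l) //= addrCA lerDl addr_ge0 // sumr_ge0 //.
  have := ler_norm (- b l); rewrite normrN => h1 h2.
  rewrite -[t * b l]opprK subr_ge0 -mulrN; apply: le_trans h2.
  by rewrite ler_pM2l.
move=> /e0X; rewrite e0t => /eqP; rewrite mulf_eq0.
by rewrite (gt_eqF t0) (gt_eqF q0).
Qed.

End Geometry.


(** * The code attached to a neighborly family *)

Lemma vline_eqP (F : fieldType) (V : vectType F) (a b : V) : b != 0 ->
  reflect (exists2 k, k != 0 & a = k *: b) (<[a]> == <[b]>)%VS.
Proof.
move=> b0; apply: (iffP eqP) => [ab|[k k0 ->]].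
  have /vlineP[k aE] : a \in <[b]>%VS by rewrite -ab memv_line.
  exists k => //; apply: contraNneq b0 => k0.
  have := memv_line b; rewrite -ab aE k0 scale0r => /vlineP[l ->].
  by rewrite scaler0.
apply/eqP; rewrite eqEdim !dim_vline scaler_eq0 (negPf k0) b0 leqnn andbT.
by rewrite -memvE memvZ ?memv_line.
Qed.

Section Family.
Variables (R : realType) (d : nat) (K : finType).
Variables (A : K -> set 'rV[R]_d) (Q : K -> 'M[R]_(1 + d)).
Hypothesis d_gt0 : (0 < d)%N.
Hypothesis Q_unit : forall v, Q v \in unitmx.
Hypothesis Q_sum : forall v x, \sum_j ev (col j (Q v)) x = 1.
Hypothesis AE : forall v x, A v x <-> forall j, 0 <= ev (col j (Q v)) x.
Hypothesis A_neighborly : forall u v, u != v -> neighborly (A u) (A v).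

Local Notation facet := (K * 'I_(1 + d))%type.
Implicit Types (u v : K) (z i : facet) (e : 'cV[R]_(1 + d)).

Definition facet_fun z : 'cV[R]_(1 + d) := col z.2 (Q z.1).

Lemma facet_indep v (a : 'I_(1 + d) -> R) :
  \sum_j a j *: facet_fun (v, j) = 0 -> forall j, a j = 0.
Proof.
have -> : \sum_j a j *: facet_fun (v, j) = Q v *m \col_j a j.
  apply/colP => k; rewrite summxE mxE; apply: eq_bigr => j _.
  by rewrite !mxE mulrC.
move=> /(congr1 (mulmx (invmx (Q v)))); rewrite mulKmx // mulmx0 => /colP h j.
by have := h j; rewrite !mxE.
Qed.

Lemma facet_fun_neq0 z : facet_fun z != 0.
Proof.
case: z => v j; apply/eqP => z0.
have s0 : \sum_k (k == j)%:R *: facet_fun (v, k) = 0; last first.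
  by have /eqP := facet_indep s0 j; rewrite eqxx oner_eq0.
by rewrite (bigD1 j) //= z0 scaler0 add0r big1 // => k /negPf ->; rewrite scale0r.
Qed.

Lemma facet_fun_inj v j j' a :
  facet_fun (v, j) = a *: facet_fun (v, j') -> j = j'.
Proof.
move=> jE; apply/eqP; apply/negPn/negP => jj'.
have s0 : \sum_k ((k == j)%:R - a * (k == j')%:R) *: facet_fun (v, k) = 0; last first.
  by have /eqP := facet_indep s0 j; rewrite eqxx (negPf jj') mulr0 subr0 oner_eq0.
rewrite (bigD1 j) //= eqxx (negPf jj') mulr0 subr0 scale1r.
rewrite (bigD1 j') /=; last by rewrite eq_sym.
rewrite eqxx (eq_sym j') (negPf jj') sub0r mulr1 jE scaleNr addrA subrr add0r.
by rewrite big1 // => k /andP[/negPf -> /negPf ->]; rewrite mulr0 subrr scale0r.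
Qed.

(* A hyperplane is encoded by a chosen facet spanning it; [hplane z] is the one
   chosen for the hyperplane of [z]. *)
Definition hplane z : facet :=
  odflt z [pick y | (<[facet_fun y]> == <[facet_fun z]>)%VS].

Lemma hplaneK z : (<[facet_fun (hplane z)]> = <[facet_fun z]>)%VS.
Proof. by rewrite /hplane; case: pickP => //= y /eqP. Qed.

Lemma hplane_eq z y :
  (<[facet_fun z]> = <[facet_fun y]>)%VS -> hplane z = hplane y.
Proof.
move=> zy; rewrite /hplane (eq_pick (Q := fun t => (<[facet_fun t]> == <[facet_fun y]>)%VS)).
  by case: pickP => // /(_ y); rewrite eqxx.
by move=> t; rewrite zy.
Qed.

Lemma hplane_scale z y : hplane z = hplane y ->
  exists2 k, k != 0 & facet_fun z = k *: facet_fun y.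
Proof.
by move=> zy; apply/vline_eqP; rewrite ?facet_fun_neq0 // -hplaneK zy hplaneK.
Qed.

Lemma hplane_par e z y a b : e != 0 -> a != 0 -> b != 0 ->
  facet_fun z = a *: e -> facet_fun y = b *: e -> hplane z = hplane y.
Proof.
move=> e0 a0 b0 zE yE; apply: hplane_eq; transitivity <[e]>%VS.
  by apply/eqP/vline_eqP => //; exists a.
by apply/esym/eqP/vline_eqP => //; exists b.
Qed.

Lemma hplane_inj v : injective (fun j => hplane (v, j)).
Proof. by move=> j j' /hplane_scale[k _]; apply: facet_fun_inj. Qed.

(** Its sign tells on which side of the hyperplane the simplex lies, relative to the chosen
    facet. *)
Definition orient z : R :=
  xget 0 [set k | k != 0 /\ facet_fun z = k *: facet_fun (hplane z)].

Lemma orientP z :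
  orient z != 0 /\ facet_fun z = orient z *: facet_fun (hplane z).
Proof.
have [k k0 kE] : exists2 k, k != 0 & facet_fun z = k *: facet_fun (hplane z).
  by apply/vline_eqP; rewrite ?facet_fun_neq0 // hplaneK.
rewrite /orient; case: xgetP => [y -> //|/(_ k)].
by case; split.
Qed.

Definition word v i : R :=
  if [pick j | hplane (v, j) == i] is Some j then Num.sg (orient (v, j)) else 0.

Lemma word_hplane v j : word v (hplane (v, j)) = Num.sg (orient (v, j)).
Proof.
rewrite /word; case: pickP => [k /eqP/hplane_inj -> //|/(_ j)].
by rewrite eqxx.
Qed.

Lemma word_neq0 v i : word v i != 0 -> exists j, i = hplane (v, j).
Proof.
rewrite /word; case: pickP => [j /eqP <- _|]; first by exists j.
by rewrite eqxx.
Qed.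

Lemma word_sqr v i : word v i != 0 -> word v i ^+ 2 = 1.
Proof.
move=> /word_neq0[j ->]; rewrite word_hplane sqr_sg.
by have [-> _] := orientP (v, j).
Qed.

Lemma supp_word v : supp (word v) = [set hplane (v, j) | j : 'I_(1 + d)]%SET.
Proof.
apply/setP => i; rewrite inE; apply/idP/imsetP => [/word_neq0[j ->]|[j _ ->]].
  by exists j.
by rewrite word_hplane sgr_eq0; have [] := orientP (v, j).
Qed.

Lemma card_supp_word v : #|supp (word v)| = (1 + d)%N.
Proof. by rewrite supp_word card_imset ?card_ord //; apply: hplane_inj. Qed.

Lemma word_opp u v i : word u i * word v i = -1 ->
  exists j j', [/\ i = hplane (u, j), i = hplane (v, j') &
    orient (u, j) * orient (v, j') < 0].
Proof.
move=> opp; have := opp_supp_r opp; have := opp_supp opp.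
rewrite !supp_word => /imsetP[j _ ij] /imsetP[j' _ ij']; exists j, j'; split=> //.
by rewrite -sgr_cp0 sgrM -!word_hplane -ij -ij' opp.
Qed.

(** Replacing [e] by the chosen functional multiplies both coefficients by the same [c], and
    [c ^+ 2 > 0] preserves the sign of their product. *)
Lemma word_opp_facets e u v j j' a b : e != 0 -> a * b < 0 ->
  facet_fun (u, j) = a *: e -> facet_fun (v, j') = b *: e ->
  word u (hplane (u, j)) * word v (hplane (u, j)) = -1.
Proof.
move=> e0 ab uE vE.
have /andP[a0 b0] : (a != 0) && (b != 0) by rewrite -negb_or -mulf_eq0 lt_eqF.
have uv : hplane (u, j) = hplane (v, j') by exact: hplane_par e0 a0 b0 uE vE.
rewrite {2}uv !word_hplane -sgrM; apply/eqP; rewrite sgr_cp0.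
have [k0 kE] := orientP (u, j); have [l0 lE] := orientP (v, j').
set f := facet_fun (hplane (u, j)) in kE; rewrite -uv -/f in lE.
have f0 : f != 0 by exact: facet_fun_neq0.
have [c c0 eE] : exists2 c, c != 0 & e = c *: f.
  exists (a^-1 * orient (u, j)); first by rewrite mulf_neq0 ?invr_eq0.
  by rewrite -scalerA -kE uE scalerA mulVf // scale1r.
have co g h : g *: f = h *: f -> g = h.
  move=> /eqP; rewrite -subr_eq0 -scalerBl scaler_eq0 (negPf f0) orbF subr_eq0.
  by move/eqP.
have -> : orient (u, j) = a * c by apply: co; rewrite -kE uE eE scalerA.
have -> : orient (v, j') = b * c by apply: co; rewrite -lE vE eE scalerA.
by rewrite mulrACA pmulr_llt0 // -expr2 exprn_even_gt0.
Qed.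

Lemma meet_functional u v : u != v -> exists e0,
  [/\ (A u `&` A v) !=set0, e0 != 0,
      forall x, (A u `&` A v) x -> ev e0 x = 0 &
      forall e, (forall x, (A u `&` A v) x -> ev e x = 0) -> exists a, e = a *: e0].
Proof. by move=> /A_neighborly; apply: hull_functional. Qed.

(** [negative_constraint], applied to [e0] and to [- e0], yields facet functions that are a negative
    and a positive multiple of [e0]. They belong to different simplices, as facets of one simplex
    span distinct hyperplanes. *)
Lemma word_opp_ex u v : u != v -> exists i, word u i * word v i = -1.
Proof.
move=> uv; have [e0 [Xn e00 e0X par]] := meet_functional uv.
pose c (l : 'I_(1 + d) + 'I_(1 + d)) :=
  match l with inl j => facet_fun (u, j) | inr j => facet_fun (v, j) end.
have XE x : (A u `&` A v) x <-> forall l, 0 <= ev (c l) x.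
  split=> [[/AE ux /AE vx] [] j|h]; [exact: ux|exact: vx|split].
    by apply/AE => j; exact: (h (inl j)).
  by apply/AE => j; exact: (h (inr j)).
have [l [a [a0 lE]]] := negative_constraint XE Xn e00 e0X (fun l => par (c l)).
have [l' [b [b0 l'E]]] : exists l b, b < 0 /\ c l = b *: - e0.
  apply: (negative_constraint XE Xn) => [|x Xx|l' /par[b ->]].
  - by rewrite oppr_eq0.
  - by rewrite -scaleN1r evZ e0X // mulr0.
  - by exists (- b); rewrite scalerN scaleNr opprK.
have {}l'E : c l' = - b *: e0 by rewrite l'E scalerN scaleNr.
have ab : a * - b < 0 by rewrite pmulr_llt0 // oppr_gt0.
have absurd w j j' : facet_fun (w, j) = a *: e0 ->
    facet_fun (w, j') = - b *: e0 -> False.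
  move=> jE j'E; have jj' : j = j'.
    apply: (@hplane_inj w); apply: (hplane_par e00) jE j'E; first by rewrite lt_eqF.
    by rewrite oppr_eq0 lt_eqF.
  move: j'E; rewrite -jj' jE => /eqP; rewrite -subr_eq0 -scalerBl scaler_eq0.
  by rewrite (negPf e00) orbF opprK lt_eqF // -[0]addr0 ltrD.
case: l l' lE l'E => [j|j] [j'|j'] /= lE l'E.
- by case: (absurd u j j').
- by exists (hplane (u, j)); apply: word_opp_facets lE l'E.
- exists (hplane (v, j)); rewrite mulrC.
  exact: word_opp_facets lE l'E.
- by case: (absurd v j j').
Qed.

(** A common point lies on both closed sides of the hyperplane. *)
Lemma word_opp_vanish u v i x : word u i * word v i = -1 ->
  A u x -> A v x -> ev (facet_fun i) x = 0.
Proof.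
move=> /word_opp[j [j' [ij ij' ab]]] /AE /(_ j) ux /AE /(_ j') vx.
have [_ uE] := orientP (u, j); have [_ vE] := orientP (v, j').
move: ux vx; rewrite -[col _ _]/(facet_fun (u, j)) -[col _ _]/(facet_fun (v, j')).
rewrite uE vE -ij -ij' !evZ; set f := ev _ _ => ux vx.
have : 0 <= orient (u, j) * orient (v, j') * f ^+ 2.
  by rewrite expr2 mulrACA mulr_ge0.
rewrite nmulr_rge0 // => f0; apply/eqP; rewrite -sqrf_eq0.
by rewrite eq_le f0 sqr_ge0.
Qed.

(** Every opposite coordinate gives a functional vanishing on the intersection, hence a multiple of
    [e0]. *)
Lemma word_opp_uniq u v i i' : u != v ->
  word u i * word v i = -1 -> word u i' * word v i' = -1 -> i = i'.
Proof.
move=> /meet_functional[e0 [_ e00 _ par]].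
have key t : word u t * word v t = -1 ->
    hplane t = t /\ exists2 a, a != 0 & facet_fun t = a *: e0.
  move=> opp; split.
    by have [j [_ [-> _ _]]] := word_opp opp; apply: hplane_eq; rewrite hplaneK.
  have [a tE] : exists a, facet_fun t = a *: e0.
    by apply: par => x [ux vx]; apply: word_opp_vanish opp ux vx.
  exists a => //; apply: contraTneq (facet_fun_neq0 t) => a0.
  by rewrite tE a0 scale0r eqxx.
move=> /key[iE [a a0 aE]] /key[i'E [b b0 bE]]; rewrite -iE -i'E.
exact: hplane_par e00 a0 b0 aE bE.
Qed.

(* The barycentric coordinates of either simplex sum to 1, so if the facets of
   both span the same hyperplanes, these coordinates agree up to order. *)
Lemma supp_word_inj : injective (fun v => supp (word v)).
Proof.
move=> u v /= uv; apply/eqP; apply: contraT => uvN.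
have /choice[s sE] (j : 'I_(1 + d)) : exists k, hplane (u, k) = hplane (v, j).
  have : hplane (v, j) \in supp (word v) by rewrite supp_word; apply/imsetP; exists j.
  by rewrite -uv supp_word => /imsetP[k _ ->]; exists k.
have s_inj : injective s.
  by move=> j j' ss; apply: (@hplane_inj v); rewrite -!sE ss.
have /choice[r rE] (j : 'I_(1 + d)) :
    exists r, facet_fun (u, s j) = r *: facet_fun (v, j).
  by have [r _ rE] := hplane_scale (sE j); exists r.
have sums : \sum_j facet_fun (u, j) = \sum_j facet_fun (v, j).
  apply: ev_inj => x.
  have evs w : ev (\sum_j facet_fun (w, j)) x = 1.
    by rewrite /ev mulmx_sumr summxE; apply: Q_sum.
  by rewrite !evs.
have r1 j : r j = 1.
  apply/eqP; rewrite -subr_eq0; apply/eqP.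
  apply: (@facet_indep v (fun j => r j - 1)).
  under eq_bigr do rewrite scalerBl scale1r -rE.
  by rewrite sumrB -sums [X in _ - X](reindex_inj s_inj) subrr.
(* At this coordinate equal facet functions force equal orientations, whose product is a square and
   not negative. *)
have [i opp] := word_opp_ex uvN.
have [j [j' [iu iv]]] := word_opp opp.
have js : j = s j' by apply: (@hplane_inj u); rewrite sE -iu -iv.
have [_] := orientP (u, j); have [_] := orientP (v, j').
rewrite -iu -iv js rE r1 scale1r => -> /eqP.
rewrite -subr_eq0 -scalerBl scaler_eq0 (negPf (facet_fun_neq0 i)) orbF subr_eq0.
by move=> /eqP ->; rewrite -expr2 ltNge sqr_ge0.
Qed.

Lemma card_family_le : (6 <= 1 + d)%N ->
  #|K|%:R + ((1 + d)%:R - 6) / 2 <= 2 ^+ (1 + d) :> R.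
Proof.
exact: card_code_le word_sqr card_supp_word word_opp_ex word_opp_uniq supp_word_inj.
Qed.

End Family.

(** * The bound on neighborly families and the limit *)

Lemma card_neighborly_le (R : realType) (d : nat) (K : finType)
    (A : K -> set 'rV[R]_d) : (0 < d)%N -> (forall v, simplex d (A v)) ->
  (forall u v, u != v -> neighborly (A u) (A v)) -> (6 <= 1 + d)%N ->
  #|K|%:R + ((1 + d)%:R - 6) / 2 <= 2 ^+ (1 + d) :> R.
Proof.
move=> d0 sA nA; have /choice[Q QP] v := simplexP (sA v).
apply: (@card_family_le R d K A Q) => // v; by case: (QP v).
Qed.

Lemma max_neighborly_le (R : realType) (d : nat) : (6 <= d)%N ->
  (max_neighborly R d <= (2 ^+ d.+1 - (d%:R - 6) / 2)%:E)%E.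
Proof.
move=> d6; apply: ge_ereal_sup => _ [F [sF nF] <-].
(* The bound is proved for finite subfamilies, so that it also rules out infinite families. *)
have fin (B : {fset (set 'rV[R]_d)}) : [set` B] `<=` F ->
    #|` B|%:R <= 2 ^+ d.+1 - (d%:R - 6) / 2 :> R.
  move=> BF; have := @card_neighborly_le R d B (fun v => fsval v).
  rewrite (leq_trans _ d6) // ltnW // => /(_ isT) h.
  have {h} := h (fun v => sF _ (BF _ (fsvalP v))) _ isT.
  rewrite -cardfE => h.
  have : #|` B|%:R + ((1 + d)%:R - 6) / 2 <= 2 ^+ (1 + d) :> R.
    apply: h => u v uv; apply: nF; [exact: BF (fsvalP u)|exact: BF (fsvalP v)|].
    by move=> /val_inj uE; rewrite uE eqxx in uv.
  rewrite natrD => {}h; rewrite lerBrDr; apply: le_trans h.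
  by rewrite lerD2l ler_pM2r ?invr_gt0 // lerD2r lerDr.
rewrite /counting; case: asboolP => [Ffin|Finf].
  by rewrite lee_fin; apply: fin; rewrite fset_setK.
(* One member more than [2 ^ d.+1] already contradicts [fin]. *)
have [B BF] := infinite_set_fset (2 ^ d.+1 + 1) Finf.
rewrite -(ler_nat R) => /le_trans/(_ (fin _ BF)).
rewrite natrD natrX lerD2l lerNr => h.
have : 0 <= (d%:R - 6) / 2 :> R by rewrite mulr_ge0 ?invr_ge0 // subr_ge0 (ler_nat _ 6).
by move=> /le_trans/(_ h); rewrite oppr_ge0 ler10.
Qed.

Theorem theorem1 (R : realType) :
  ((2 ^+ d.+1)%:E - max_neighborly R d)%E @[d --> \oo] --> (+oo%E : \bar R).
Proof.
apply/cvgeyPge => M; near=> d.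
have d6 : (6 <= d)%N by near: d; exact: nbhs_infty_ge.
apply: (@le_trans _ _ ((d%:R - 6) / 2)%:E).
  rewrite lee_fin ler_pdivlMr // lerBrDr.
  (* Here [d] has to be at least [M * 2 + 6]. *)
  by near: d; exact: nbhs_infty_ger.
have := max_neighborly_le R d6; rewrite -leeN2 => h.
apply: le_trans (leeD2l _ h).
by rewrite -EFinN -EFinD lee_fin opprB addrCA subrr addr0.
Unshelve. all: by end_near.
Qed.
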